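(* Let $Q_0=(Q,* )$ be a noncommutative quasigroup and let $Q'$ be a quasigroup. Then $Q_0\stackrel{H}{\cong}Q'$ if and only if $Q'$ is isomorphic to a principal h-quasigroup of $Q_0$.
   Context: A groupoid is a nonempty set with a binary operation. A groupoid $(Q,* )$ is a quasigroup if for all $a,b\in Q$ the equations $a*x=b$ and $y*a=b$ have unique solutions $x,y\in Q$. For groupoids $(A,* )$ and $(B,\cdot)$, a bijection $f:A\to B$ is a half-isomorphism if $f(x*y)\in\{f(x)\cdot f(y),f(y)\cdot f(x)\}$ for all $x,y\in A$; it is special if $f^{-1}$ is also a half-isomorphism. $A\stackrel{H}{\cong}B$ means that there exists a special half-isomorphism between $A$ and $B$. A principal h-quasigroup of $Q_0=(Q,* )$ is a quasigroup $(Q,\cdot)$ on the same underlying set $Q$ for which the identity mapping $Q_0\to(Q,\cdot)$ is a special half-isomorphism. *)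

(* Defs.v *)
From mathcomp Require Import all_boot.

Set Implicit Arguments.
Unset Strict Implicit.
Unset Printing Implicit Defensive.

(* A groupoid is given by a type together with a binary operation on it, so
   that several operations on the same underlying set can be compared; the
   nonemptiness of its carrier is part of [quasigroup]. *)
Definition quasigroup (A : Type) (op : A -> A -> A) : Prop :=
  [/\ inhabited A,
      forall a b : A, exists! x : A, op a x = b
    & forall a b : A, exists! y : A, op y a = b].

Section Maps.

Variables (A B : Type) (opA : A -> A -> A) (opB : B -> B -> B).

Definition isomorphism (f : A -> B) : Prop :=
  bijective f /\ {morph f : x y / opA x y >-> opB x y}.

Definition isomorphic : Prop := exists f : A -> B, isomorphism f.

Definition half_isomorphism (f : A -> B) : Prop :=
  bijective f /\
  forall x y : A,
    f (opA x y) = opB (f x) (f y) \/ f (opA x y) = opB (f y) (f x).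

End Maps.

Definition special_half_isomorphism (A B : Type) (opA : A -> A -> A)
    (opB : B -> B -> B) (f : A -> B) : Prop :=
  half_isomorphism opA opB f /\
  exists g : B -> A, [/\ cancel f g, cancel g f & half_isomorphism opB opA g].

Definition specially_half_isomorphic (A B : Type) (opA : A -> A -> A)
    (opB : B -> B -> B) : Prop :=
  exists f : A -> B, special_half_isomorphism opA opB f.

Definition principal_h_quasigroup (Q : Type) (star dot : Q -> Q -> Q) : Prop :=
  quasigroup dot /\ special_half_isomorphism star dot (fun x : Q => x).

(* Main.v *)
Require Import Defs.
From mathcomp Require Import all_boot.

(** A special half-isomorphism splits into an identity map that changes the operation, followed by
    an isomorphism. Given [f] from [star] to [op'] with inverse [g], pull [op'] back along [f]: then
    [g] is an isomorphism onto the new operation, a quasigroup by [quasigroup_transport], and the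
    half-morphism laws of [f] and [g] become those of the identity. Conversely, composing the
    identity with an isomorphism keeps both laws. *)

Lemma quasigroup_transport (A B : Type) (opA : A -> A -> A) (f : B -> A)
    (g : A -> B) :
  cancel f g -> cancel g f -> quasigroup opA ->
  quasigroup (fun x y => g (opA (f x) (f y))).
Proof.
move=> fK gK [[a0] divl divr]; split; first by exists; exact: g a0.
- move=> a b; have [x [opx uniqx]] := divl (f a) (f b).
  exists (g x); split; first by rewrite gK opx fK.
  by move=> y opy; rewrite (uniqx (f y)) ?fK // -opy gK.
- move=> a b; have [x [opx uniqx]] := divr (f a) (f b).
  exists (g x); split; first by rewrite gK opx fK.
  by move=> y opy; rewrite (uniqx (f y)) ?fK // -opy gK.
Qed.

Theorem proposition5p1 (Q Q' : Type) (star : Q -> Q -> Q) (op' : Q' -> Q' -> Q')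
    (hQ : quasigroup star) (hnc : ~ commutative star) (hQ' : quasigroup op') :
  specially_half_isomorphic star op' <->
  exists dot : Q -> Q -> Q,
    principal_h_quasigroup star dot /\ isomorphic op' dot.
Proof.
split=> [[f [[_ fM] [g [fK gK [_ gM]]]]] | [dot [[_ [[_ idM] [j [jK _ [_ jM]]]]]]]].
- exists (fun x y => g (op' (f x) (f y))); split.
  + split; first exact: (quasigroup_transport Q' Q op' f g fK gK hQ').
    have id_bij : bijective (fun x : Q => x) by exists id.
    (* Here the identity is viewed as [g] after [f], so the alternative holding for [f] carries over
       unchanged. *)
    split; first split=> // x y.
      by case: (fM x y) => <-; rewrite fK; [left | right].
    exists id; split=> //; split=> // x y.
    by case: (gM (f x) (f y)) => ->; rewrite !fK; [left | right].
  + by exists g; split=> [|x y]; [exists f | rewrite !gK].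
- case=> h [[k hK kK] hM].
  have kM x y : k (dot x y) = op' (k x) (k y).
    by apply: (can_inj hK); rewrite kK hM !kK.
  exists k; split.
    split=> [|x y]; first by exists h.
    by case: (idM x y) => ->; rewrite kM; [left | right].
  exists h; split=> //; split=> [|x y]; first by exists k.
  (* The inverse [j] of the identity is only given existentially; cancellation forces it to be the
     identity, so [jM] relates [dot] back to [star]. *)
  have jE z : j z = z := jK z.
  by move: (jM (h x) (h y)); rewrite hM !jE.
Qed.
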